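(* Let $0\le\alpha<n$, $m$ a nonnegative integer, $0<\eta\le1$, $0<\delta<\min\{\eta,(n-\alpha)/m\}$, $\tilde\alpha=m\delta+\alpha$. For every $1\le r\le\infty$ and every $\tilde\delta\le\min\{\delta,\tilde\alpha-n/r\}$, excluding the case $\tilde\delta=\delta$ when $\tilde\alpha-n/r=\delta$, there exists a pair of weights $(w,v)$ with $v$ not identically zero such that $(w,v)\in\mathbb{H}(r,\tilde\alpha,\tilde\delta)$.
   Context: A weight is a nonnegative locally integrable function; $w(B)=\int_Bw$; $x_B$ the center of $B$; $r'$ the conjugate exponent. $(w,v)\in\mathbb{H}(r,\tilde\alpha,\tilde\delta)$ means that for some $C$ and every ball $B$: if $1<r\le\infty$, $|B|^{(\delta-\tilde\delta)/n}\big(\int\frac{v^{r'}(y)}{(|B|^{1/n}+|x_B-y|)^{r'(n-\tilde\alpha+\delta)}}dy\big)^{1/r'}\le C\frac{w(B)}{|B|}$; if $r=1$, $|B|^{(\delta-\tilde\delta)/n}\big\|\frac{v(\cdot)}{(|B|^{1/n}+|x_B-\cdot|)^{n-\tilde\alpha+\delta}}\big\|_\infty\le C\frac{w(B)}{|B|}$. If $m=0$, $(n-\alpha)/m$ is read as $+\infty$. *)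

(* Defs.v *)
From HB Require Import structures.
From mathcomp Require Import all_boot all_order all_algebra.
From mathcomp Require Import all_classical all_reals all_analysis.
Set Implicit Arguments. Unset Strict Implicit. Unset Printing Implicit Defensive.
Import Order.TTheory GRing.Theory Num.Theory.
Import numFieldNormedType.Exports.
Local Open Scope classical_set_scope.
Local Open Scope ring_scope.

(* Points of R^n are n-tuples of reals (with the product = Borel sigma-algebra). *)

(* Lebesgue integral over R^n of a nonnegative function, defined as the
   iterated one-dimensional Lebesgue integral (by Tonelli this is the integral
   w.r.t. n-dimensional Lebesgue measure for nonnegative measurable f). *)
Fixpoint iint {R : realType} (n : nat) : (n.-tuple R -> \bar R) -> \bar R :=
  match n return (n.-tuple R -> \bar R) -> \bar R with
  | 0 => fun f => f [tuple]
  | k.+1 => fun f =>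
      (\int[@lebesgue_measure R]_x iint (fun t : k.-tuple R => f (cons_tuple x t)))%E
  end.

Definition edist {R : realType} (n : nat) (x y : n.-tuple R) : R :=
  Num.sqrt (\sum_(i < n) (tnth x i - tnth y i) ^+ 2).

Definition ballind {R : realType} (n : nat) (c : n.-tuple R) (rho : R)
  (y : n.-tuple R) : R := ((edist c y < rho)%R : bool)%:R.

Definition ballvol {R : realType} (n : nat) (c : n.-tuple R) (rho : R) : \bar R :=
  iint (fun y => (ballind c rho y)%:E).

Definition wball {R : realType} (n : nat) (w : n.-tuple R -> R)
  (c : n.-tuple R) (rho : R) : \bar R :=
  iint (fun y => (ballind c rho y * w y)%:E).

Definition esssup {R : realType} (n : nat) (g : n.-tuple R -> \bar R) : \bar R :=
  ereal_inf [set M : \bar R |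
     iint (fun y => ((M < g y)%E)%:R%:E) = 0%E].

Definition weight {R : realType} (n : nat) (w : n.-tuple R -> R) : Prop :=
  measurable_fun [set: n.-tuple R] w /\
  (forall y, 0 <= w y) /\
  (forall (c : n.-tuple R) (rho : R), 0 < rho -> (wball w c rho < +oo)%E).

Definition conj_exp {R : realType} (r : \bar R) : \bar R :=
  match r with
  | +oo%E => 1%E
  | r0%:E => if r0 == 1 then +oo%E else (r0 / (r0 - 1))%:E
  | -oo%E => 1%E
  end.

Definition HH {R : realType} (n : nat) (delta : R) (r : \bar R) (alt dt : R)
  (w v : n.-tuple R -> R) : Prop :=
  exists C : R, forall (c : n.-tuple R) (rho : R), 0 < rho ->
    let B := fine (ballvol c rho) in
    let Bn := B `^ (n%:R^-1) in
    let e := n%:R - alt + delta in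
    let rhs := (C%:E * (wball w c rho * (B^-1)%:E))%E in
    if r == 1%E then
      ((B `^ ((delta - dt) / n%:R))%:E *
        esssup (fun y => (v y / (Bn + edist c y) `^ e)%:E) <= rhs)%E
    else
      let q := fine (conj_exp r) in
      ((B `^ ((delta - dt) / n%:R))%:E *
        (iint (fun y => (v y `^ q / (Bn + edist c y) `^ (q * e))%:E))
          `^ (q^-1) <= rhs)%E.

(* Main.v *)
(** Take for v the indicator of the unit cube and w(x) = 1 + |x_0|^s with
    s = delta - delta~ >= 0; put t = |B|^(1/n), q = r' and
    e = n - alpha~ + delta.  The average of w over any ball is at least a
    multiple of 1 + t^s, so it suffices to bound
    t^s || 1_Q / (t + |x_B - .|)^e ||_q by a multiple of 1 + t^s.  Since
    (t + |x - y|)^(-qe) <= prod_i (t + |x_i - y_i|)^(-qe/n), the integral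
    splits into one-dimensional ones, each at most 1 + K t^(-qs/n) as soon as
    qe/n <= 1 + qs/n, which is delta~ <= alpha~ - n/r; the logarithmic case
    s = 0, qe = n is precisely the excluded one. *)

Require Import Defs.
From HB Require Import structures.
From mathcomp Require Import all_boot all_order all_algebra.
From mathcomp Require Import all_classical all_reals all_analysis measurable_realfun.
From mathcomp Require Import ring lra.
Set Implicit Arguments. Unset Strict Implicit. Unset Printing Implicit Defensive.
Import Order.TTheory GRing.Theory Num.Theory.
Import numFieldNormedType.Exports.
Local Open Scope ring_scope.

(** * Iterated integrals: monotonicity and product integrands *)

Lemma le_integral_nomeas (d : measure_display) (T : measurableType d)
    (R : realType) (mu : {measure set T -> \bar R}) (f g : T -> \bar R) :
  (forall x, 0 <= f x)%E -> (forall x, f x <= g x)%E ->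
  (\int[mu]_x f x <= \int[mu]_x g x)%E.
Proof.
move=> f0 fg; have g0 x : (0 <= g x)%E by exact: le_trans (f0 x) (fg x).
(* The integral of a nonnegative function is a supremum over the simple functions below it, and this
   set grows with the function. Slices of ball indicators can thus be compared without discussing
   their measurability. *)
rewrite !ge0_integralTE//; apply: ereal_sup_le => _ [h /= hf <-].
by exists h => //= x; apply: le_trans (hf x) (fg x).
Qed.

Lemma iint_ge0 (R : realType) (n : nat) (f : n.-tuple R -> \bar R) :
  (forall y, 0 <= f y)%E -> (0 <= iint f)%E.
Proof.
elim: n f => [|n IH] f f0 /=; first exact: f0.
by apply: integral_ge0 => x _; exact: IH.
Qed.

Lemma le_iint (R : realType) (n : nat) (f g : n.-tuple R -> \bar R) :
  (forall y, 0 <= f y)%E -> (forall y, f y <= g y)%E -> (iint f <= iint g)%E.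
Proof.
elim: n f g => [|n IH] f g f0 fg /=; first exact: fg.
apply: le_integral_nomeas => x; first exact: iint_ge0.
exact: IH.
Qed.

(** The constant [a] is what makes the induction close: on a slice the first factor [g ord0 x] is
    absorbed into it, and it is then pulled out of the outer integral. *)
Lemma iint_prod (R : realType) (n : nat) (g : 'I_n -> R -> R) (G : 'I_n -> R)
    (a : R) :
  (forall i, measurable_fun [set: R] (g i)) -> (forall i x, 0 <= g i x) ->
  (forall i, (\int[@lebesgue_measure R]_x (g i x)%:E = (G i)%:E)%E) ->
  0 <= a ->
  iint (fun y : n.-tuple R => (a * \prod_i g i (tnth y i))%:E) =
  (a * \prod_i G i)%:E.
Proof.
elim: n g G a => [|n IH] g G a mg g0 gG a0 /=; first by rewrite !big_ord0.
have iE x : iint (fun t : n.-tuple R =>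
    (a * \prod_i g i (tnth (cons_tuple x t) i))%:E) =
    ((a * \prod_i G (lift ord0 i))%:E * (g ord0 x)%:E)%E.
  rewrite -EFinM mulrAC -(IH (fun i => g (lift ord0 i)))//; last first.
    by rewrite mulr_ge0.
  congr iint; apply/funext => y; rewrite big_ord_recl mulrA tnth0.
  by congr ((_ * _)%:E); apply: eq_bigr => i _; rewrite tnthS.
under eq_integral do rewrite iE.
have G0 i : 0 <= G i by rewrite -lee_fin -gG integral_ge0// => x _; rewrite lee_fin.
rewrite ge0_integralZl_EFin//; first by rewrite gG -EFinM mulrAC -mulrA -big_ord_recl.
- by move=> x _; rewrite lee_fin.
- by apply/measurable_EFinP; exact: mg.
- by rewrite mulr_ge0// prodr_ge0.
Qed.

(** * The kernel on the line, integrated over the unit interval *)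

Lemma integral_affine_powR (R : realType) (b s p l u : R) :
  s ^+ 2 = 1 -> p != 1 -> l < u -> (forall y, l <= y <= u -> 0 < b + s * y) ->
  (\int[@lebesgue_measure R]_(y in `[l, u]%classic) ((b + s * y) `^ (- p))%:E =
  (s / (1 - p) * ((b + s * u) `^ (1 - p) - (b + s * l) `^ (1 - p)))%:E)%E.
Proof.
move=> s2 p1 lu pos.
have p1' : 1 - p != 0 by rewrite subr_eq0 eq_sym.
(* Differentiating the inner affine map gives a second factor [s], which cancels by [s ^+ 2 = 1].
   The signs 1 and -1 will serve the points to the right and to the left of the singularity. *)
pose F y := s / (1 - p) * (b + s * y) `^ (1 - p).
have dG (a : R) y : l <= y <= u -> is_derive y 1 (fun y => (b + s * y) `^ a)
    (a * (b + s * y) `^ (a - 1) * s).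
  move=> ylu; have d1 : is_derive y 1 (fun y => b + s * y) s.
    by apply: is_derive_eq; rewrite add0r mul1r /GRing.scale/= mulr1.
  exact: (@is_derive1_comp R (fun z => z `^ a) (fun y => b + s * y) _ _ _
    (is_derive1_powR a (pos _ ylu)) d1).
have cG (a : R) y : l <= y <= u -> {for y, continuous (fun y => (b + s * y) `^ a)}.
  by move=> /(dG a) [+ _] => /derivable1_diffP/differentiable_continuous.
have dF y : l <= y <= u -> is_derive y 1 F ((b + s * y) `^ (- p)).
  move=> /(dG (1 - p)) H; apply: is_derive_eq.
  rewrite /GRing.scale/= (_ : 1 - p - 1 = - p); last by ring.
  by rewrite mulrCA -mulrA; transitivity (s ^+ 2 * (b + s * y) `^ (- p)); [field|rewrite s2 mul1r].
have cF y : l <= y <= u -> {for y, continuous F}.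
  by move=> /dF [+ _] => /derivable1_diffP/differentiable_continuous.
rewrite (@continuous_FTC2 _ _ F)//.
- by rewrite -EFinB /F mulrBr.
- apply/continuous_in_subspaceT => y; rewrite inE/= in_itv/= => ylu.
  exact: cG.
- split.
  + move=> y; rewrite in_itv/= => /andP[ly yu].
    by have [] := dF y; rewrite ?(ltW ly) ?(ltW yu).
  + apply: cvg_at_right_filter. by apply: cF; rewrite lexx (ltW lu).
  + apply: cvg_at_left_filter. by apply: cF; rewrite lexx (ltW lu).
- move=> y; rewrite in_itv/= => /andP[ly yu].
  rewrite derive1E; have := dF y; rewrite (ltW ly) (ltW yu) => /(_ isT) H.
  by rewrite derive_val.
Qed.

Lemma integral_indic_mul (d : measure_display) (T : measurableType d)
    (R : realType) (mu : {measure set T -> \bar R}) (D : set T) (f : T -> R) :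
  (\int[mu]_x (\1_D x * f x)%:E = \int[mu]_(x in D) (f x)%:E)%E.
Proof.
rewrite [RHS]integral_mkcond; congr integral; apply/funext => x.
by rewrite /patch indicE; case: ifP; rewrite (mul1r, mul0r).
Qed.

Lemma integral_indic_itvcc (R : realType) (a b : R) : a <= b ->
  (\int[@lebesgue_measure R]_x (\1_(`[a, b]%classic) x)%:E = (b - a)%:E)%E.
Proof.
move=> ab; rewrite integral_indic//= setIT lebesgue_measure_itv/=.
rewrite lte_fin; case: ltP => [_|ba]; first by rewrite -EFinB.
by have -> : a = b by [apply/eqP; rewrite eq_le ab ba]; rewrite subrr.
Qed.

Lemma measurable_kernel (R : realType) (t x p : R) :
  measurable_fun [set: R] (fun y => (t + `|x - y|) `^ (- p)).
Proof.
apply: (measurableT_comp (measurable_powR _)); apply: measurable_funD => //.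
apply: measurableT_comp => //; exact: measurable_funB.
Qed.

(* Only the excluded borderline case [b = 0], [a = 1] produces a logarithm. *)
Lemma kernel_integral_bound (R : realType) (a b : R) :
  0 <= a -> (0 < b /\ a <= 1 + b) \/ (b = 0 /\ a < 1) ->
  exists2 K : R, 0 <= K & forall t x : R, 0 < t ->
    (\int[@lebesgue_measure R]_y
       (\1_(`[0, 1]%classic) y * (t + `|x - y|) `^ (- a))%:E
     <= (1 + K * t `^ (- b))%:E)%E.
Proof.
move=> a0 ab.
(* Where the base is at most 1, raising the exponent from [a] to [p] only enlarges the kernel.
   Taking [p = 1 + b] for [b > 0], and [p = a < 1] for [b = 0], avoids the logarithmic primitive at
   exponent 1. *)
have [p [ap p1 hp]] : exists p, [/\ a <= p, p != 1 &
    (p = 1 + b /\ 0 < b) \/ (b = 0 /\ 0 <= p < 1)].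
  case: ab => [[b0 ab]|[b0 a1]].
    by exists (1 + b); split => //; [rewrite -subr_eq0 addrAC subrr add0r gt_eqF|left].
  by exists a; split; [|rewrite lt_eqF|right; rewrite a0 a1].
have p1' : 1 - p != 0 by rewrite subr_eq0 eq_sym.
(* The 2 comes from the case [b = 0], where (t + 1)^(1 - p) <= t + 1 <= 2 for t <= 1. *)
pose k := 2 / `|1 - p|.
have k0 : 0 <= k by rewrite divr_ge0.
have J (t : R) : 0 < t <= 1 ->
    ((t + 1) `^ (1 - p) - t `^ (1 - p)) / (1 - p) <= k * t `^ (- b).
  move=> /andP[t0 t1]; case: hp => [[pE b0]|[b0 /andP[p0 plt1]]].
    have -> : 1 - p = - b by rewrite pE; ring.
    rewrite /k pE (_ : 1 - (1 + b) = - b); last by ring.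
    rewrite normrN gtr0_norm// invrN mulrN -mulNr opprB mulrAC ler_pM2r ?invr_gt0//.
    have := powR_ge0 (t + 1) (- b); have := powR_ge0 t (- b); lra.
  have q0 : 0 < 1 - p by rewrite subr_gt0.
  rewrite b0 oppr0 powRr0 mulr1 /k gtr0_norm// ler_pM2r ?invr_gt0//.
  have h1 : (t + 1) `^ (1 - p) <= t + 1.
    by apply: ler1_powR; lra.
  have := powR_ge0 t (1 - p); lra.
have m01 : measurable (`[0, 1]%classic : set R) by exact: measurable_itv.
have i01 := @integral_indic_itvcc R 0 1 ler01; rewrite subr0 in i01.
exists (k + k) => [|t x t0]; first exact: addr_ge0.
have ker0 (y c : R) : 0 <= \1_(`[0, 1]%classic) y * (t + `|x - y|) `^ c :> R.
  by rewrite mulr_ge0// powR_ge0.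
(* For t > 1 the kernel is at most 1, and the unit interval has length 1. *)
have [t1|t1] := leP t 1; last first.
  apply: (@le_trans _ _ 1%:E); last first.
    by rewrite lee_fin lerDl mulr_ge0 ?powR_ge0// addr_ge0.
  rewrite -i01; apply: le_integral_nomeas => y; first by rewrite lee_fin.
  rewrite lee_fin ler_piMr// powRN invf_le1 ?powR_gt0 ?ltr_wpDr//.
  by rewrite -[leLHS](powRr0 (t + `|x - y|)) ler_powR//; have := normr_ge0 (x - y); lra.
(* Three majorants: [f1] handles the points where t + |x - y| >= 1, so that the kernel is at most 1.
   Elsewhere |x - y| < 1, and [f2] or [f3] handles y right or left of x. Their intervals are centred
   on x rather than cut by [0, 1], which makes the bound uniform in x. *)
pose f1 (y : R) : R := \1_(`[0, 1]%classic) y.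
pose f2 (y : R) : R := \1_(`[x, x + 1]%classic) y * (t - x + 1 * y) `^ (- p).
pose f3 (y : R) : R := \1_(`[x - 1, x]%classic) y * (t + x + (-1) * y) `^ (- p).
have f10 y : 0 <= f1 y by rewrite /f1.
have f20 y : 0 <= f2 y by rewrite mulr_ge0// powR_ge0.
have f30 y : 0 <= f3 y by rewrite mulr_ge0// powR_ge0.
apply: (@le_trans _ _ (\int[@lebesgue_measure R]_y (f1 y + (f2 y + f3 y))%:E)%E).
  apply: le_integral_nomeas => y; rewrite lee_fin//.
  have [tu|tu] := leP 1 (t + `|x - y|).
    apply: (@le_trans _ _ (f1 y)); last by rewrite lerDl addr_ge0.
    rewrite ler_piMr// powRN invf_le1 ?powR_gt0 ?ltr_wpDr//.
    by rewrite -[leLHS](powRr0 (t + `|x - y|)) ler_powR.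
  apply: (@le_trans _ _ (f2 y + f3 y)); last by rewrite lerDr.
  apply: (@le_trans _ _ ((t + `|x - y|) `^ (- p))).
    rewrite (@le_trans _ _ ((t + `|x - y|) `^ (- a)))//.
      by rewrite ler_piMl ?powR_ge0// indicE lern1 leq_b1.
    by rewrite ger_powR ?lerN2// (ltW tu) andbT ltr_wpDr.
  have [xy|xy] := leP x y.
    apply: (@le_trans _ _ (f2 y)); last by rewrite lerDl.
    move: tu; rewrite ler0_norm ?subr_le0// => tu.
    rewrite /f2 indicE mem_set/= ?in_itv/= ?xy/=; last lra.
    by rewrite [leRHS]mul1r; have -> : t - (x - y) = t - x + 1 * y by ring.
  apply: (@le_trans _ _ (f3 y)); last by rewrite lerDr.
  move: tu; rewrite gtr0_norm ?subr_gt0// => tu.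
  rewrite /f3 indicE mem_set/= ?in_itv/= ?(ltW xy)/= ?andbT; last lra.
  by rewrite [leRHS]mul1r; have -> : t + (x - y) = t + x + -1 * y by ring.
have mf1 : measurable_fun [set: R] f1 by exact: measurable_indic.
have maff (u v : R) : measurable_fun [set: R] (fun y => (u + v * y) `^ (- p)).
  apply: (measurableT_comp (measurable_powR _)); apply: measurable_funD => //.
have mf2 : measurable_fun [set: R] f2.
  by apply: measurable_funM => //; apply: measurable_indic; exact: measurable_itv.
have mf3 : measurable_fun [set: R] f3.
  by apply: measurable_funM => //; apply: measurable_indic; exact: measurable_itv.
rewrite (_ : (fun y => _) = (fun y => (f1 y)%:E + ((f2 y)%:E + (f3 y)%:E))%E); last first.
  by apply/funext => y; rewrite !EFinD.
rewrite ge0_integralD//=; last first.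
- by apply: emeasurable_funD; exact/measurable_EFinP.
- by move=> y _; rewrite -EFinD lee_fin addr_ge0.
- exact/measurable_EFinP.
- by move=> y _; rewrite lee_fin.
rewrite ge0_integralD//=; last first.
- exact/measurable_EFinP.
- by move=> y _; rewrite lee_fin.
- exact/measurable_EFinP.
- by move=> y _; rewrite lee_fin.
rewrite i01 !integral_indic_mul !integral_affine_powR//; last 6 first.
- by rewrite sqrrN expr1n.
- by rewrite ltrBlDr ltrDl.
- move=> y; lra.
- by rewrite expr1n.
- by rewrite ltrDl.
- move=> y; lra.
have := J t; rewrite t0 t1 => /(_ isT) Jt.
rewrite -!EFinD lee_fin lerD2l mulrDl lerD//.
  apply: le_trans Jt; rewrite le_eqVlt; apply/orP; left; apply/eqP.
  have -> : t - x + 1 * (x + 1) = t + 1 by ring.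
  have -> : t - x + 1 * x = t by ring.
  by rewrite mul1r mulrC.
apply: le_trans Jt; rewrite le_eqVlt; apply/orP; left; apply/eqP.
have -> : t + x + -1 * x = t by ring.
have -> : t + x + -1 * (x - 1) = t + 1 by ring.
by rewrite mulN1r mulNr -mulrN opprB mulrC.
Qed.

(** * Comparison of balls with boxes *)

Section Boxes.
Variables (R : realType) (n : nat).
Implicit Types (c x y : n.-tuple R) (l u : 'I_n -> R) (rho sg : R).

(** The product form lets [iint_prod] compute volumes; [boxindE] gives the pointwise form used for
    inclusions. *)
Definition boxind l u y : R := \prod_i \1_(`[l i, u i]%classic) (tnth y i).

Lemma boxindE l u y : boxind l u y = [forall i, l i <= tnth y i <= u i]%:R.
Proof.
rewrite /boxind; case: forallP => [h|/existsNP[i /negP hi]].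
  by rewrite big1// => i _; rewrite indicE mem_set//= in_itv/=.
rewrite (bigD1 i)//= indicE memNset ?mul0r//.
by apply/negP; rewrite /= in_itv/=.
Qed.

Lemma iint_boxind (a : R) l u : 0 <= a -> (forall i, l i <= u i) ->
  iint (fun y => (a * boxind l u y)%:E) = (a * \prod_i (u i - l i))%:E.
Proof.
move=> a0 lu; apply: (@iint_prod R n (fun i => \1_(`[l i, u i]%classic)) (fun i => u i - l i)) => //.
by move=> i; exact: integral_indic_itvcc.
Qed.

Lemma coord_le_edist x y i : `|tnth x i - tnth y i| <= Defs.edist x y.
Proof.
rewrite /Defs.edist -sqrtr_sqr ler_wsqrtr// (bigD1 i)//= lerDl sumr_ge0// => j _.
exact: sqr_ge0.
Qed.

Lemma edist_le_coord x y sg : 0 <= sg ->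
  (forall i, `|tnth x i - tnth y i| <= sg) -> Defs.edist x y <= n%:R * sg.
Proof.
move=> sg0 h; have ns0 : 0 <= n%:R * sg by rewrite mulr_ge0.
rewrite /Defs.edist -[leRHS]ger0_norm// -sqrtr_sqr ler_wsqrtr//.
apply: (@le_trans _ _ (\sum_(i < n) sg ^+ 2)).
  by apply: ler_sum => i _; rewrite -real_normK ?num_real// lerXn2r ?nnegrE.
rewrite sumr_const card_ord -[leLHS]mulr_natl exprMn ler_wpM2r ?sqr_ge0//.
by rewrite -natrX ler_nat -mulnn; case: (n) => // k; rewrite leq_pmulr.
Qed.

Lemma ballind_ge0 c rho y : 0 <= ballind c rho y.
Proof. by rewrite /ballind ler0n. Qed.

Lemma boxind_le_ballind c rho sg l u y : 0 <= sg -> n%:R * sg < rho ->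
  (forall i, tnth c i - sg <= l i /\ u i <= tnth c i + sg) ->
  boxind l u y <= ballind c rho y.
Proof.
move=> sg0 nsg lu; rewrite boxindE /ballind ler_nat.
case: forallP => [h|//]; rewrite lt0b (le_lt_trans _ nsg)//.
apply: edist_le_coord => // i; rewrite ler_norml.
by have /andP[] := h i; have [] := lu i; lra.
Qed.

Lemma ballind_le_boxind c rho y :
  ballind c rho y <=
  boxind (fun i => tnth c i - rho) (fun i => tnth c i + rho) y.
Proof.
rewrite boxindE /ballind ler_nat; case: ltP => // cy; rewrite lt0b.
apply/forallP => i; have := le_lt_trans (coord_le_edist c y i) cy.
by rewrite ltr_norml; lra.
Qed.

(** The ball contains the cube of half-side [sg] and lies in the cube of half-side [rho]. The volume
    is therefore finite, so that [fine] loses nothing in [HH]. The inequality on [sg] is strict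
    because the cubes are closed and the ball is open. *)
Lemma ballvol_bounds c rho sg : 0 < rho -> 0 <= sg -> n%:R * sg < rho ->
  exists B : R, ballvol c rho = B%:E /\ (sg *+ 2) ^+ n <= B <= (rho *+ 2) ^+ n.
Proof.
move=> rho0 sg0 nsg.
have up : (ballvol c rho <= ((rho *+ 2) ^+ n)%:E)%E.
  have := @iint_boxind 1 (fun i => tnth c i - rho) (fun i => tnth c i + rho) ler01.
  rewrite mul1r (eq_bigr (fun=> rho *+ 2)); last by move=> i _; rewrite mulr2n; ring.
  rewrite prodr_const card_ord => <-; last by move=> i; lra.
  apply: le_iint => y; rewrite lee_fin ?ballind_ge0// mul1r.
  exact: ballind_le_boxind.
have lo : (((sg *+ 2) ^+ n)%:E <= ballvol c rho)%E.
  have := @iint_boxind 1 (fun i => tnth c i - sg) (fun i => tnth c i + sg) ler01.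
  rewrite mul1r (eq_bigr (fun=> sg *+ 2)); last by move=> i _; rewrite mulr2n; ring.
  rewrite prodr_const card_ord => <-; last by move=> i; lra.
  apply: le_iint => y; rewrite lee_fin mul1r; first by rewrite boxindE.
  by apply: (boxind_le_ballind y sg0 nsg).
move: up lo; case: (ballvol c rho) => [B| |]; rewrite ?lee_fin// => up lo.
by exists B; rewrite lo up.
Qed.

End Boxes.

(** * The two weights and lower bounds for averages *)

Section Weights.
Variables (R : realType) (k : nat).
Local Notation n := k.+1.

Definition cube_weight (y : n.-tuple R) : R := boxind (fun=> 0) (fun=> 1) y.

Definition growing_weight (s : R) (y : n.-tuple R) : R :=
  1 + `|tnth y ord0| `^ s.

Lemma iint_cube_weight : iint (fun y => (cube_weight y)%:E) = 1%E.
Proof.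
have := @iint_boxind R n 1 (fun=> 0) (fun=> 1) ler01 (fun=> ler01).
rewrite mul1r subr0 big1// => <-; congr iint; apply/funext => y.
by rewrite mul1r.
Qed.

Lemma weight_cube_weight : weight cube_weight.
Proof.
split; [|split].
- rewrite /cube_weight /boxind; apply: measurable_prod => i _.
  apply: measurableT_comp; last exact: measurable_tnth.
  exact: measurable_indic.
- by move=> y; rewrite /cube_weight boxindE.
- move=> c rho rho0; apply: (@le_lt_trans _ _ 1%E); last exact: ltry.
  rewrite -iint_cube_weight; apply: le_iint => y; rewrite lee_fin.
    by rewrite mulr_ge0 ?ballind_ge0// /cube_weight boxindE.
  by rewrite ler_piMl// ?lern1 ?leq_b1// /cube_weight boxindE.
Qed.

Lemma growing_weight_ge0 (s : R) y : 0 <= growing_weight s y.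
Proof. by rewrite addr_ge0// powR_ge0. Qed.

Lemma weight_growing_weight (s : R) : 0 <= s -> weight (growing_weight s).
Proof.
move=> s0; split; [|split].
- apply: measurable_funD => //; apply: (measurableT_comp (measurable_powR _)).
  by apply: measurableT_comp => //; exact: measurable_tnth.
- exact: growing_weight_ge0.
- move=> c rho rho0; pose M := 1 + (`|tnth c ord0| + rho) `^ s.
  have M0 : 0 <= M by rewrite addr_ge0// powR_ge0.
  apply: (@le_lt_trans _ _ (iint (fun y => (M * boxind
    (fun i => tnth c i - rho) (fun i => tnth c i + rho) y)%:E))); last first.
    by rewrite iint_boxind// ?ltry// => i; lra.
  apply: le_iint => y; rewrite lee_fin.
    by rewrite mulr_ge0 ?ballind_ge0// growing_weight_ge0.
  apply: (@le_trans _ _ (M * ballind c rho y)); last first.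
    by rewrite ler_wpM2l// ballind_le_boxind.
  rewrite /ballind; case: ltP => cy; last by rewrite mul0r mulr0.
  rewrite mul1r mulr1 lerD2l ge0_ler_powR// ?nnegrE ?addr_ge0// ?(ltW rho0)//.
  have := le_lt_trans (coord_le_edist c y ord0) cy.
  rewrite distrC => /ltW h; rewrite -lerBlDl (le_trans _ h)//.
  exact: lerB_dist.
Qed.

Lemma ball_side (rho : R) : n%:R * (rho / (2 * n%:R)) = rho / 2.
Proof. by field; rewrite nat1r pnatr_eq0. Qed.

(** From the cube of half-side [sg] around [c], keep the quarter whose first coordinate lies
    farthest from 0 on the side of [c]: above [tnth c ord0 + sg / 2] if that coordinate of [c] is
    nonnegative, below [tnth c ord0 - sg / 2] otherwise. There the first coordinate has modulus at
    least [sg / 2]. *)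
Lemma wball_growing_weight (s rho sg : R) (c : n.-tuple R) :
  0 <= s -> 0 < sg -> n%:R * sg < rho ->
  (((1 + (sg / 2) `^ s) * (sg / 2 * (sg *+ 2) ^+ k))%:E <=
   wball (growing_weight s) c rho)%E.
Proof.
move=> s0 sg0 nsg.
pose l i := if (i == ord0) && (0 <= tnth c ord0) then tnth c i + sg / 2
  else tnth c i - sg.
pose u i := if (i == ord0) && (tnth c ord0 < 0) then tnth c i - sg / 2
  else tnth c i + sg.
have -> : sg / 2 * (sg *+ 2) ^+ k = \prod_i (u i - l i).
  rewrite big_ord_recl /u /l eqxx/=; congr (_ * _).
    by case: ltP => _; field.
  rewrite (eq_bigr (fun=> sg *+ 2)); last by move=> i _ /=; rewrite mulr2n; ring.
  by rewrite prodr_const card_ord.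
have M0 : 0 <= 1 + (sg / 2) `^ s by rewrite addr_ge0// powR_ge0.
rewrite -iint_boxind//; last first.
  move=> i; rewrite /l /u; case: eqP => _ /=; last by lra.
  by case: ltP => _; lra.
apply: le_iint => y; rewrite lee_fin; first by rewrite mulr_ge0// boxindE.
apply: (@le_trans _ _ (growing_weight s y * boxind l u y)); last first.
  rewrite [leRHS]mulrC ler_wpM2l ?growing_weight_ge0//.
  apply: (boxind_le_ballind y (ltW sg0) nsg) => i.
  by rewrite /l /u; case: eqP => _ /=; [case: ltP => _|]; lra.
rewrite boxindE; case: forallP => [/(_ ord0) h|_]; last first.
  by rewrite !mulr0.
rewrite !mulr1 lerD2l ge0_ler_powR// ?nnegrE//; first by lra.
move: h; rewrite /l /u eqxx/=; case: ltP => c0 /andP[h1 h2].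
  by rewrite ler0_norm; lra.
by rewrite ger0_norm; lra.
Qed.

End Weights.

(* In any ball, wherever its center lies, the first coordinate exceeds a
   fixed multiple of the radius on a definite proportion of the volume. *)
Lemma growing_weight_average (R : realType) (k : nat) (s : R) : 0 <= s ->
  exists2 C : R, 0 <= C & forall (c : k.+1.-tuple R) (rho : R), 0 < rho ->
    let B := fine (ballvol c rho) in
    0 < B /\
    ((1 + (B `^ (k.+1%:R^-1)) `^ s)%:E <=
      C%:E * (wball (growing_weight s) c rho * (B^-1)%:E))%E.
Proof.
move=> s0; set n := k.+1; pose N : R := n%:R.
have N1 : 1 <= N by rewrite ler1n.
have N0 : 0 < N by rewrite ltr0n.
(* With [sg = rho / (2 * N)], [A] compares powers through t <= 2 rho = 8 N (sg / 2), and [D]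
   compares volumes: |B| <= (2 rho)^n, which is [D] times the volume of the box in
   [wball_growing_weight]. *)
pose A := (8 * N) `^ s; pose D := 4 * (2 * N) ^+ n.
have A1 : 1 <= A by rewrite -[leLHS](powRr0 (8 * N)) ler_powR//; lra.
have D0 : 0 < D by rewrite mulr_gt0// exprn_gt0// mulr_gt0.
exists (A * D) => [|c rho rho0 B]; first by rewrite mulr_ge0 ?(ltW D0)//; lra.
pose sg := rho / (2 * N).
have sg0 : 0 < sg by rewrite divr_gt0// mulr_gt0.
have Nsg : N * sg = rho / 2 by exact: ball_side.
have nsg : n%:R * sg < rho by rewrite -/N Nsg; lra.
have [B' [vB' /andP[lB uB]]] := ballvol_bounds c rho0 (ltW sg0) nsg.
have BE : B = B' by rewrite /B vB'.
rewrite -{B' vB'}BE in lB uB *.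
have B0 : 0 < B by rewrite (lt_le_trans _ lB)// exprn_gt0// pmulrn_lgt0.
split=> //; set t := B `^ _.
have t0 : 0 <= t by exact: powR_ge0.
have trho : t <= 8 * N * (sg / 2).
  have -> : 8 * N * (sg / 2) = rho *+ 2.
    by rewrite (_ : _ * _ = N * sg * 4); [rewrite Nsg mulr2n; field|field].
  have r20 : 0 <= rho *+ 2 by rewrite mulrn_wge0// ltW.
  rewrite /t (_ : rho *+ 2 = ((rho *+ 2) ^+ n) `^ n%:R^-1); last first.
    by rewrite -powR_mulrn// -powRrM divff ?powRr1// gt_eqF.
  by rewrite ge0_ler_powR// ?nnegrE ?invr_ge0 ?exprn_ge0 ?(ltW B0).
have ts : t `^ s <= A * (sg / 2) `^ s.
  rewrite /A -powRM; [|lra|lra].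
  by rewrite ge0_ler_powR// ?nnegrE// (le_trans t0).
have W := wball_growing_weight c s0 sg0 nsg.
set P := (sg / 2) `^ s in ts W.
have P0 : 0 <= P by exact: powR_ge0.
set Q := sg / 2 * (sg *+ 2) ^+ k in W.
have BQ : B <= D * Q.
  apply: (le_trans uB); rewrite le_eqVlt; apply/orP; left; apply/eqP.
  rewrite /D /Q (_ : 4 * _ * _ = (2 * N) ^+ n * (sg *+ 2) ^+ n); last first.
    by rewrite /n !exprS !mulr2n; field.
  by rewrite -exprMn; congr (_ ^+ _); rewrite !mulr2n; move: Nsg; lra.
rewrite (muleC (wball _ _ _)) muleA -EFinM.
apply: (@le_trans _ _ ((A * D * B^-1)%:E * ((1 + P) * Q)%:E)%E); last first.
  rewrite lee_wpmul2l// lee_fin mulr_ge0 ?invr_ge0 ?(ltW B0)//.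
  by rewrite mulr_ge0 ?(ltW D0)//; lra.
rewrite -EFinM lee_fin.
have h1 : 1 + t `^ s <= A * (1 + P).
  by rewrite mulrDr mulr1 lerD.
apply: (le_trans h1).
rewrite (_ : A * D * B^-1 * _ = A * (1 + P) * (D * Q / B)); last by ring.
by rewrite ler_peMr ?ler_pdivlMr ?mul1r// mulr_ge0; lra.
Qed.

(** * Kernel estimates for the cube weight *)

Lemma cube_weight_powR (R : realType) (k : nat) (y : k.+1.-tuple R) (q : R) :
  q != 0 -> cube_weight y `^ q = cube_weight y.
Proof.
by move=> q0; rewrite /cube_weight boxindE; case: [forall _, _]; rewrite (powR1, powR0).
Qed.

(** Each coordinate distance is at most the Euclidean one, so each of the n factors of exponent
    [p / n] dominates the n-th root of the kernel. *)
Lemma cube_kernel_le (R : realType) (k : nat) (t p q : R) (c y : k.+1.-tuple R) :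
  0 < t -> 0 <= p -> q != 0 ->
  cube_weight y `^ q / (t + Defs.edist c y) `^ p <=
  \prod_(i < k.+1) (\1_(`[0, 1]%classic) (tnth y i) *
    (t + `|tnth c i - tnth y i|) `^ (- (p / k.+1%:R))).
Proof.
move=> t0 p0 q0; rewrite cube_weight_powR// big_split/= -/(boxind _ _ y).
have d0 : 0 <= Defs.edist c y by exact: sqrtr_ge0.
rewrite ler_wpM2l//; first by rewrite /cube_weight boxindE.
rewrite -powRN (_ : - p = - (p / k.+1%:R) * k.+1%:R); last first.
  by rewrite mulNr divfK// pnatr_eq0.
rewrite powRrM powR_mulrn ?powR_ge0// -[X in _ ^+ X]card_ord -prodr_const.
apply: ler_prod => i _; rewrite powR_ge0/= !powRN lef_pV2 ?posrE ?powR_gt0 ?ltr_wpDr//.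
rewrite ge0_ler_powR ?divr_ge0 ?nnegrE ?addr_ge0 ?(ltW t0)//.
by rewrite lerD2l coord_le_edist.
Qed.

Lemma cube_kernel_bound (R : realType) (k : nat) (q e s : R) :
  0 < q -> 0 <= e -> 0 <= s ->
  q * (e - s) <= k.+1%:R -> ~ (s = 0 /\ q * e = k.+1%:R) ->
  exists2 C : R, 0 <= C & forall (t : R) (c : k.+1.-tuple R), 0 < t ->
    ((t `^ s)%:E *
      (iint (fun y => (cube_weight y `^ q /
         (t + Defs.edist c y) `^ (q * e))%:E)) `^ (q^-1)
     <= (C * (1 + t `^ s))%:E)%E.
Proof.
move=> q0 e0 s0 hqe excl; set n := k.+1; pose N : R := n%:R.
have N0 : 0 < N by rewrite ltr0n.
(* These are the exponents per coordinate. The hypotheses become [a <= 1 + b] and the exclusion of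
   [a = 1], [b = 0], as [kernel_integral_bound] requires. *)
pose a := q * e / N; pose b := q * s / N.
have a0 : 0 <= a by rewrite divr_ge0 ?mulr_ge0 ?(ltW q0) ?(ltW N0).
have b0 : 0 <= b by rewrite divr_ge0 ?mulr_ge0 ?(ltW q0) ?(ltW N0).
have ab : a <= 1 + b.
  by rewrite /a /b ler_pdivrMr// mulrDl divfK ?gt_eqF// mul1r; move: hqe; rewrite -/n -/N; lra.
have [|K K0 hK] := @kernel_integral_bound R a b a0.
  move: b0; rewrite le_eqVlt => /orP[/eqP b0|b0]; [right|by left].
  have s00 : s = 0.
    apply/eqP; move/eqP: b0; rewrite eq_sym /b mulf_eq0 invr_eq0 (gt_eqF N0) orbF.
    by rewrite mulf_eq0 (gt_eqF q0).
  split=> //; rewrite lt_neqAle; apply/andP; split; last by move: ab; rewrite -b0 addr0.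
  apply/eqP => a1; apply: excl; split=> //.
  by rewrite -/n -/N -[RHS]mul1r -a1 divfK// gt_eqF.
pose g (t : R) (c : n.-tuple R) (i : 'I_n) (y : R) : R :=
  \1_(`[0, 1]%classic) y * (t + `|tnth c i - y|) `^ (- a).
(* This [r] is not the integrability exponent: it results from n coordinate bounds followed by the
   power 1/q. *)
pose r := N / q.
have r0 : 0 <= r by rewrite divr_ge0 ?(ltW N0) ?(ltW q0).
have K1 : 0 <= 1 + K by rewrite addr_ge0.
exists ((1 + K) `^ r) => [|t c t0]; first exact: powR_ge0.
have g0 i y : 0 <= g t c i y by rewrite mulr_ge0 ?powR_ge0.
have tb0 : 0 < t `^ b by exact: powR_gt0.
have M0 : 0 <= 1 + K * t `^ (- b) by rewrite addr_ge0// mulr_ge0// powR_ge0.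
pose G i : R := fine (\int[@lebesgue_measure R]_y (g t c i y)%:E)%E.
have GE i : (\int[@lebesgue_measure R]_y (g t c i y)%:E)%E = (G i)%:E.
  rewrite /G fineK// fin_numElt (lt_le_trans (ltNyr 0)) ?integral_ge0//=; last first.
    by move=> y _; rewrite lee_fin.
  by apply: le_lt_trans (hK t (tnth c i) t0) _; rewrite ltry.
have Gb i : 0 <= G i <= 1 + K * t `^ (- b).
  rewrite -!lee_fin -GE hK// andbT; apply: integral_ge0 => y _.
  by rewrite lee_fin.
set I := iint _.
have Ile : (I <= ((1 + K * t `^ (- b)) ^+ n)%:E)%E.
  apply: (@le_trans _ _ (1 * \prod_(i < n) G i)%:E); last first.
    rewrite lee_fin mul1r -[X in _ ^+ X]card_ord -prodr_const.
    by apply: ler_prod => i _; exact: Gb.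
  rewrite -(@iint_prod R n (g t c) G 1)//; last first.
    move=> i; apply: measurable_funM; last exact: measurable_kernel.
    exact: measurable_indic.
  apply: le_iint => y; rewrite lee_fin ?mul1r.
    by rewrite divr_ge0 ?powR_ge0.
  by apply: cube_kernel_le => //; [rewrite mulr_ge0// ltW|rewrite gt_eqF].
have I0 : (0 <= I)%E.
  by apply: iint_ge0 => y; rewrite lee_fin divr_ge0 ?powR_ge0.
have Iq : (I `^ (q^-1) <= ((1 + K * t `^ (- b)) `^ r)%:E)%E.
  rewrite /r powRrM powR_mulrn// -poweR_EFin.
  apply: gt0_ler_poweR => //; first by rewrite invr_ge0 ltW.
  - by rewrite in_itv/= I0 leey.
  - by rewrite in_itv/= lee_fin exprn_ge0// leey.
apply: (@le_trans _ _ ((t `^ s)%:E * ((1 + K * t `^ (- b)) `^ r)%:E)%E).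
  by rewrite lee_wpmul2l// lee_fin powR_ge0.
rewrite -EFinM lee_fin.
(* Since [b * r = s], the factor t^s enters the r-th power and cancels the singular t^(-b), leaving
   (t^b + K)^r. *)
have tsE : t `^ s = (t `^ b) `^ r.
  rewrite -powRrM; congr (_ `^ _); rewrite /b /r; field.
  by rewrite !gt_eqF.
have -> : t `^ s * (1 + K * t `^ (- b)) `^ r = (t `^ b + K) `^ r.
  rewrite tsE -powRM ?powR_ge0//; congr (_ `^ _).
  by rewrite mulrDr mulr1 mulrCA powRN divff ?mulr1// gt_eqF.
(* If t^b <= 1 the base is at most 1 + K, and the summand 1 suffices; otherwise it is at most (1 +
   K) t^b, and the summand t^s suffices. *)
rewrite tsE; have [tb|tb] := leP (t `^ b) 1.
  apply: (@le_trans _ _ ((1 + K) `^ r)).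
    by rewrite ge0_ler_powR// ?nnegrE ?addr_ge0 ?powR_ge0// lerD2r.
  by rewrite ler_peMr ?powR_ge0// lerDl powR_ge0.
apply: (@le_trans _ _ (((1 + K) * t `^ b) `^ r)).
  rewrite ge0_ler_powR// ?nnegrE ?mulr_ge0 ?addr_ge0 ?powR_ge0//.
  by rewrite mulrDl mul1r lerD2l ler_peMr// ltW.
by rewrite powRM ?powR_ge0// ler_wpM2l ?powR_ge0// lerDr.
Qed.

Lemma esssup_le (R : realType) (n : nat) (g : n.-tuple R -> \bar R) (M : \bar R) :
  (forall y, g y <= M)%E -> (esssup g <= M)%E.
Proof.
move=> gM; apply: ereal_inf_lbound => /=.
rewrite (_ : (fun y => _) = fun=> 0%E); last first.
  by apply/funext => y; rewrite ltNge gM.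
by elim: n {g gM} => [//|n IH] /=; rewrite integral0_eq.
Qed.

(** The supremum is at most t^(-e), so t^(s - e) has to be bounded: by 1 for t <= 1 since [e <= s],
    by t^s for t > 1 since [e >= 0]. *)
Lemma esssup_cube_kernel (R : realType) (k : nat) (e s : R) : 0 <= e -> e <= s ->
  forall (t : R) (c : k.+1.-tuple R), 0 < t ->
    ((t `^ s)%:E *
      esssup (fun y => (cube_weight y / (t + Defs.edist c y) `^ e)%:E)
     <= (1 + t `^ s)%:E)%E.
Proof.
move=> e0 es t c t0.
apply: (@le_trans _ _ ((t `^ s)%:E * (t `^ (- e))%:E)%E).
  rewrite lee_wpmul2l ?lee_fin ?powR_ge0//; apply: esssup_le => y.
  rewrite lee_fin powRN ler_pdivrMr ?powR_gt0 ?ltr_wpDr ?sqrtr_ge0//.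
  apply: (@le_trans _ _ 1).
    by rewrite /cube_weight boxindE lern1 leq_b1.
  rewrite mulrC ler_pdivlMr ?powR_gt0// mul1r ge0_ler_powR ?nnegrE ?addr_ge0 ?(ltW t0) ?sqrtr_ge0//.
  by rewrite lerDl sqrtr_ge0.
rewrite -EFinM lee_fin -powRD; last by rewrite (gt_eqF t0) implybT.
have [t1|t1] := leP t 1.
  apply: (@le_trans _ _ 1); last by rewrite lerDl powR_ge0.
  by rewrite -[leRHS](powRr0 t) ger_powR ?t0// subr_ge0.
apply: (@le_trans _ _ (t `^ s)); last by rewrite lerDr.
by rewrite ler_powR ?(ltW t1)//; lra.
Qed.

(** * Conjugate exponents and the final choice of parameters *)

Lemma conj_exp_gt1 (R : realType) (r : \bar R) (n : R) :
  (1 <= r)%E -> r != 1%E ->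
  let n_r := (match r with +oo%E => 0 | r0%:E => n / r0 | -oo%E => 0 end) in
  0 < fine (conj_exp r) /\ fine (conj_exp r) * (n - n_r) = n.
Proof.
case: r => [r| |]//= r1 rn1; last by rewrite subr0 mul1r.
have rgt1 : 1 < r by rewrite lt_neqAle eq_sym -eqe rn1 -lee_fin.
have r0 : r != 0 by rewrite gt_eqF// (lt_trans _ rgt1).
have r10 : r - 1 != 0 by rewrite gt_eqF// subr_gt0.
rewrite (gt_eqF rgt1)/=; split; last by field; rewrite r0 r10.
by rewrite divr_gt0 ?subr_gt0// (lt_trans _ rgt1).
Qed.

Unset Implicit Arguments.

Theorem theorem3p10 (R : realType) (n m : nat) (alpha eta delta : R) :
  0 <= alpha -> alpha < n%:R ->
  0 < eta -> eta <= 1 ->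
  0 < delta -> delta < eta ->
  ((0 < m)%N -> delta < (n%:R - alpha) / m%:R) ->
  forall (r : \bar R) (dt : R),
    (1 <= r)%E ->
    let alt := m%:R * delta + alpha in
    let n_r := (match r with +oo%E => 0 | r0%:E => n%:R / r0 | -oo%E => 0 end) in
    dt <= delta -> dt <= alt - n_r ->
    ~ (alt - n_r = delta /\ dt = delta) ->
    exists w v : n.-tuple R -> R,
      weight w /\ weight v /\ (0 < iint (fun y => (v y)%:E))%E /\
      HH delta r alt dt w v.
Proof.
move=> alpha0 + _ _ delta0 _ + r dt r1.
case: n => [|k alphan deltam alt n_r dtd dta excl]; first by rewrite ltNge alpha0.
(* This is where the upper bound on [delta] acts: it gives [e >= 0], so the kernel decays. *)
have altn : alt < k.+1%:R.
  rewrite /alt; have [->|m0] := posnP m; first by rewrite mul0r add0r.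
  by have := deltam m0; rewrite ltr_pdivlMr ?ltr0n// mulrC; lra.
pose s := delta - dt; have s0 : 0 <= s by rewrite subr_ge0.
pose e := k.+1%:R - alt + delta; have e0 : 0 <= e by rewrite /e; lra.
exists (growing_weight s), (@cube_weight R k); split; first exact: weight_growing_weight.
split; first exact: weight_cube_weight.
split; first by rewrite iint_cube_weight.
have [A A0 hA] := growing_weight_average k s0.
(* The radius enters only through t = |B|^(1/n), so it is enough to bound the left side by 1 + t^s
   for every t > 0; the average of the growing weight then dominates 1 + t^s. *)
suff [C C0 hC] : exists2 C : R, 0 <= C & forall (t : R) (c : k.+1.-tuple R), 0 < t ->
    (if r == 1%E then
      ((t `^ s)%:E *
        esssup (fun y => (cube_weight y / (t + Defs.edist c y) `^ e)%:E) <=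
          (C * (1 + t `^ s))%:E)%E
    else
      let q := fine (conj_exp r) in
      ((t `^ s)%:E *
        (iint (fun y => (cube_weight y `^ q / (t + Defs.edist c y) `^ (q * e))%:E))
          `^ (q^-1) <= (C * (1 + t `^ s))%:E)%E).
  exists (C * A) => c rho rho0; cbv zeta; rewrite -/e.
  set B := fine (ballvol c rho); set Bn := B `^ _^-1; set rhs := ((C * A)%:E * _)%E.
  have [B0 hB] := hA c rho rho0; rewrite -/B -/Bn in B0 hB.
  have Bs : B `^ ((delta - dt) / k.+1%:R) = Bn `^ s by rewrite mulrC powRrM.
  have rhsE : ((C * (1 + Bn `^ s))%:E <= rhs)%E.
    by rewrite /rhs !EFinM -muleA lee_wpmul2l// lee_fin.
  have := hC Bn c (powR_gt0 _ B0); rewrite Bs.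
  by case: ifP => _ /= h; exact: le_trans h rhsE.
have [rE|rN1] := eqVneq r 1%E.
  (* For r = 1, [dt <= alt - n_r] says exactly [e <= s]. *)
  exists 1 => // t c t0; rewrite mul1r; apply: esssup_cube_kernel => //.
  by move: dta; rewrite /n_r rE divr1 /e /s; lra.
have [q0 qn] := @conj_exp_gt1 R r k.+1%:R r1 rN1.
set q := fine _ in q0 qn *; rewrite -/n_r in qn.
apply: cube_kernel_bound => //.
  (* Here e - s = n - alt + dt <= n - n_r, and q (n - n_r) = n. *)
  rewrite -[leRHS]qn ler_wpM2l ?(ltW q0)// /e /s; lra.
(* Cancelling q in q e = n = q (n - n_r) gives alt - n_r = delta, while s = 0 gives dt = delta. *)
move=> [s00 qe]; apply: excl.
have : q * (e - (k.+1%:R - n_r)) = 0 by rewrite mulrBr qe qn subrr.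
move/eqP; rewrite mulf_eq0 (gt_eqF q0)/= => /eqP.
by move: s00; rewrite /e /s => ? ?; split; lra.
Qed.
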